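(* Let $(R_1,f_1,g_1)$ and $(R_2,f_2,g_2)$ be two commutative Krasner $(m,n)$-hyperrings with nonzero scalar identities $1_{R_1}$ and $1_{R_2}$, and let $h:R_1\to R_2$ be a homomorphism. Then: (1) If $h$ is a monomorphism and $P_2$ is an $n$-ary $wsq$-primary hyperideal of $R_2$, then $h^{-1}(P_2)$ is an $n$-ary $wsq$-primary hyperideal of $R_1$. (2) If $h$ is an epimorphism and $P_1$ is an $n$-ary $wsq$-primary hyperideal of $R_1$ with $\mathrm{Ker}(h)\subseteq P_1$, then $h(P_1)$ is an $n$-ary $wsq$-primary hyperideal of $R_2$.
   Context: Notation: $m,n\ge 2$; $a_i^j$ denotes the sequence $a_i,a_{i+1},\dots,a_j$ (empty if $j<i$), and $a^{(k)}$ denotes $a$ repeated $k$ times. An $m$-ary hyperoperation $f$ on $R$ assigns to every $m$-tuple a nonempty subset of $R$ (a singleton is identified with its element). For nonempty subsets, $f(A_1^m)=\bigcup\{f(a_1^m): a_i\in A_i\}$ and $g(A_1^n)=\{g(a_1^n): a_i\in A_i\}$; an element $x$ in an argument stands for $\{x\}$. A canonical $m$-ary hypergroup $(R,f)$: $f$ is associative and commutative; there is a unique $0\in R$ with $f(x,0^{(m-1)})=\{x\}$ for all $x$; each $x$ has a unique $-x$ with $0\in f(x,-x,0^{(m-2)})$; and $x\in f(x_1^m)$ implies $x_i\in f(x,-x_1,\dots,-x_{i-1},-x_{i+1},\dots,-x_m)$ for each $i$. A Krasner $(m,n)$-hyperring $(R,f,g)$: $(R,f)$ is a canonical $m$-ary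 hypergroup, $g:R^n\to R$ is associative ($n$-ary semigroup), $g$ is distributive over $f$ in each argument, i.e. $g(a_1^{i-1},f(x_1^m),a_{i+1}^n)=f(g(a_1^{i-1},x_1,a_{i+1}^n),\dots,g(a_1^{i-1},x_m,a_{i+1}^n))$, and $0$ is absorbing for $g$. Commutative means $g$ is symmetric in its arguments; a scalar identity $1$ satisfies $g(x,1^{(n-1)})=x$ for all $x$. A homomorphism $h:R_1\to R_2$ is a map with $h(1_{R_1})=1_{R_2}$, $h(f_1(x_1^m))=f_2(h(x_1),\dots,h(x_m))$ and $h(g_1(y_1^n))=g_2(h(y_1),\dots,h(y_n))$ for all $x_1^m,y_1^n\in R_1$. A monomorphism (epimorphism) is an injective (surjective) homomorphism, and $\mathrm{Ker}(h)=\{x\in R_1: h(x)=0\}$. A hyperideal of $R$ is a nonempty $I\subseteq R$ that is an $m$-ary subhypergroup of $(R,f)$ (closed under $f$ and under $x\mapsto -x$) with $g(a_1^{i-1},I,a_{i+1}^n)\subseteq I$ for all $a_1^n\in R$ and all $i$. A proper hyperideal $Q$ is ($n$-ary) prime if $g(a_1^n)\in Q$ with $a_1^n\in R$ implies $a_i\in Q$ for some $i$. The radical $\mathbf{r}^{(m,n)}(I)$ of a hyperideal $I$ is the intersection of all prime hyperideals containing $I$ (equal to $R$ if there are none). A proper hyperideal $P$ of $R$ is $n$-ary $wsq$-primary (weakly strongly quasi-primary) if for all $r_1^n\in R$, $0\ne g(r_1^n)\in P$ implies $g(r_i^{(2)},1^{(n-2)})\in P$ or $g(r_1^{i-1},1,r_{i+1}^n)\in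 \mathbf{r}^{(m,n)}(P)$ for some $1\le i\le n$.
   Formalization: Part (1) additionally assumes h(0)=0, which the stated definition of homomorphism does not give; without it (1) fails, e.g. h(x)=(x,1) from F_2 to F_2×S (S the sign hyperfield) with P_2={0}, whose preimage is empty. *)

(* Defs.v *)
From mathcomp Require Import all_boot all_fingroup.
From mathcomp Require Import boolp classical_sets.

Set Implicit Arguments.
Unset Strict Implicit.
Unset Printing Implicit Defensive.

Local Open Scope classical_set_scope.

(* A k-tuple of elements of T is a function 'I_k -> T, indexed from 0. *)

(* (s_0, ..., s_{l-1}, d^(k-l)), where l = size s <= k. *)
Definition padded (k : nat) (T : Type) (d : T) (s : seq T) : 'I_k -> T :=
  fun j => nth d s j.

(* (a_0, ..., a_{i-1}, x, a_{i+1}, ..., a_{k-1}) *)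
Definition replace (k : nat) (T : Type) (a : 'I_k -> T) (i : 'I_k) (x : T) :
  'I_k -> T := [eta a with i |-> x].

(* (x_0, ..., x_{i-1}, y, x_{i+k}, ..., x_{2k-2}): the arguments of the outer
   operation when y stands for the inner operation applied to
   x_i, ..., x_{i+k-1}.  Only the first 2k-1 terms of x matter. *)
Definition nested (k : nat) (T : Type) (x : nat -> T) (i : 'I_k) (y : T) :
  'I_k -> T :=
  fun j => if j < i then x j else if j == i then y else x (j + k).-1.

Definition block (k : nat) (T : Type) (x : nat -> T) (i : nat) : 'I_k -> T :=
  fun l => x (i + l).

Definition setlift (k : nat) (T : Type) (f : ('I_k -> T) -> set T)
    (A : 'I_k -> set T) : set T :=
  \bigcup_(a in [set a : 'I_k -> T | forall i, A i (a i)]) f a.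

Record canonical_hypergroup (m : nat) (R : Type) (f : ('I_m -> R) -> set R)
    (zero : R) (opp : R -> R) : Prop := CanonicalHypergroup {
  hyp_nonempty : forall a, f a !=set0;
  hyp_assoc : forall (x : nat -> R) (i j : 'I_m),
    setlift f (nested (fun l => [set x l]) i (f (block x i))) =
    setlift f (nested (fun l => [set x l]) j (f (block x j)));
  hyp_comm : forall (s : {perm 'I_m}) a, f (fun i => a (s i)) = f a;
  hyp_zero : forall x, f (padded zero [:: x]) = [set x];
  hyp_zero_unique : forall z,
    (forall x, f (padded z [:: x]) = [set x]) -> z = zero;
  hyp_opp : forall x, f (padded zero [:: x; opp x]) zero;
  hyp_opp_unique : forall x y, f (padded zero [:: x; y]) zero -> y = opp x;
  hyp_reversible : forall x a, f a x -> forall i,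
    f (padded zero (x :: [seq opp (a j) | j <- enum 'I_m & j != i])) (a i)
}.

Record krasner_axioms (m n : nat) (R : Type) (f : ('I_m -> R) -> set R)
    (g : ('I_n -> R) -> R) (zero : R) (opp : R -> R) : Prop := KrasnerAxioms {
  krasner_hypergroup : canonical_hypergroup f zero opp;
  krasner_assoc : forall (x : nat -> R) (i j : 'I_n),
    g (nested x i (g (block x i))) = g (nested x j (g (block x j)));
  krasner_distr : forall (a : 'I_n -> R) (i : 'I_n) (x : 'I_m -> R),
    [set g (replace a i y) | y in f x] = f (fun j => g (replace a i (x j)));
  krasner_absorb : forall (a : 'I_n -> R) (i : 'I_n), g (replace a i zero) = zero
}.

Record krasnerHyperring (m n : nat) : Type := KrasnerHyperring {
  carrier :> Type;
  hadd : ('I_m -> carrier) -> set carrier;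
  hmul : ('I_n -> carrier) -> carrier;
  hzero : carrier;
  hopp : carrier -> carrier;
  krasnerP : krasner_axioms hadd hmul hzero hopp
}.

Arguments hadd {m n} R _ : rename.
Arguments hmul {m n} R _ : rename.
Arguments hzero {m n} R : rename.
Arguments hopp {m n} R _ : rename.

Section Hyperrings.
Variables m n : nat.
Implicit Types R : krasnerHyperring m n.

Definition mul_commutative R : Prop :=
  forall (s : {perm 'I_n}) (a : 'I_n -> R),
    hmul R (fun i => a (s i)) = hmul R a.

(* For n > 2 a scalar identity need not be unique, so the chosen one is an
   explicit parameter wherever the identity is used. *)
Definition scalar_identity R (e : R) : Prop :=
  forall x : R, hmul R (padded e [:: x]) = x.

Record hyperideal R (I : set R) : Prop := Hyperideal {
  hyperideal_nonempty : I !=set0;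
  hyperideal_add : forall a : 'I_m -> R, (forall i, I (a i)) -> hadd R a `<=` I;
  hyperideal_opp : forall x, I x -> I (hopp R x);
  hyperideal_mul : forall (a : 'I_n -> R) (i : 'I_n) (x : R),
    I x -> I (hmul R (replace a i x))
}.

Definition proper_hyperideal R (I : set R) : Prop :=
  hyperideal I /\ I <> setT.

Definition prime_hyperideal R (Q : set R) : Prop :=
  proper_hyperideal Q /\
  forall a : 'I_n -> R, Q (hmul R a) -> exists i, Q (a i).

Definition radical R (I : set R) : set R :=
  \bigcap_(Q in [set Q : set R | prime_hyperideal Q /\ I `<=` Q]) Q.

Definition wsq_primary R (e : R) (P : set R) : Prop :=
  proper_hyperideal P /\
  forall r : 'I_n -> R, hmul R r <> hzero R -> P (hmul R r) ->
    exists i : 'I_n,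
      P (hmul R (padded e [:: r i; r i])) \/
      radical P (hmul R (replace r i e)).

(* Preservation of zero is not part of this definition and does not follow
   from it. *)
Record homomorphism (R1 R2 : krasnerHyperring m n) (e1 : R1) (e2 : R2)
    (h : R1 -> R2) : Prop := Homomorphism {
  hom_one : h e1 = e2;
  hom_add : forall x : 'I_m -> R1,
    h @` hadd R1 x = hadd R2 (fun i => h (x i));
  hom_mul : forall y : 'I_n -> R1,
    h (hmul R1 y) = hmul R2 (fun i => h (y i))
}.

Definition hom_kernel (R1 R2 : krasnerHyperring m n) (h : R1 -> R2) : set R1 :=
  [set x | h x = hzero R2].

Definition monomorphism (R1 R2 : krasnerHyperring m n) (e1 : R1) (e2 : R2)
    (h : R1 -> R2) : Prop :=
  homomorphism e1 e2 h /\ injective h.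

Definition epimorphism (R1 R2 : krasnerHyperring m n) (e1 : R1) (e2 : R2)
    (h : R1 -> R2) : Prop :=
  homomorphism e1 e2 h /\ forall y, exists x, h x = y.

End Hyperrings.

(* Main.v *)
Require Import Defs.
From mathcomp Require Import all_boot all_fingroup.
From mathcomp Require Import boolp classical_sets.

(** Both parts carry the [wsq]-primary alternative along [h], and only its
    second half, membership in a radical, takes work.

    For an epimorphism it passes from [P1] to [h @` P1] because the preimage of
    a prime containing [h @` P1] is a prime containing [P1] ([image_radical]).
    The rest of that part rests on [hyperideal_saturated]: a hyperideal
    containing the kernel is the full preimage of its image, so a product lying
    in [h @` P1] lifts to a product lying in [P1], and [h @` P1] is proper.

    For a monomorphism the question is whether [h y \in radical P2] forces [y]
    into every prime [Q] over the preimage of [P2] ([preimage_radical]).  The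
    textbook argument describes the radical by powers; here the separation
    lemma [prime_avoiding] is applied directly to the image of the complement
    of [Q].  That lemma is the classical one, a hyperideal maximal among those
    avoiding a multiplicatively closed set being prime, and it needs no
    description of sums of hyperideals: colon hyperideals suffice to see that
    the product of the hyperideals generated by [M] and the [a_i] stays in [M]
    when [g(a) \in M] ([hmul_generated]). *)

Local Open Scope classical_set_scope.

Section Hyperrings.
Set Implicit Arguments.
Unset Strict Implicit.
Unset Printing Implicit Defensive.

(** * Tuples *)

Lemma replaceE (k : nat) (T : Type) (a : 'I_k -> T) (i : 'I_k) (x : T) j :
  replace a i x j = if j == i then x else a j.
Proof. by []. Qed.

Lemma replace_id (k : nat) (T : Type) (a : 'I_k -> T) (i : 'I_k) :
  replace a i (a i) = a.
Proof. by apply/funext => j; rewrite replaceE; case: eqP => [->|]. Qed.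

Lemma map_replace (k : nat) (T U : Type) (h : T -> U) (a : 'I_k -> T) i x :
  (fun j => h (replace a i x j)) = replace (fun j => h (a j)) i (h x).
Proof. by apply/funext => j; rewrite !replaceE; case: ifP. Qed.

Lemma map_padded (k : nat) (T U : Type) (h : T -> U) (d : T) (s : seq T) :
  (fun j : 'I_k => h (padded d s j)) = padded (h d) (map h s).
Proof.
apply/funext => j; rewrite /padded; case: (ltnP j (size s)) => js.
  by rewrite (nth_map d).
by rewrite !nth_default ?size_map.
Qed.

(** * Hyperideals *)

Section Hyperideals.
Context {m n : nat}.
Implicit Types R : krasnerHyperring m n.

Lemma hopp_eq R (x y : R) :
  hadd R (padded (hzero R) [:: x; y]) (hzero R) -> y = hopp R x.
Proof. exact: (hyp_opp_unique (krasner_hypergroup (krasnerP R))). Qed.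

Lemma hadd_opp R (x : R) :
  hadd R (padded (hzero R) [:: x; hopp R x]) (hzero R).
Proof. exact: (hyp_opp (krasner_hypergroup (krasnerP R))). Qed.

(** By distributivity, multiplying [0 \in x + (- x)] by the remaining factors
    gives [0] in the sum of the two products. *)
Lemma hmul_opp R (a : 'I_n -> R) i (x : R) :
  hmul R (replace a i (hopp R x)) = hopp R (hmul R (replace a i x)).
Proof.
apply: hopp_eq.
have := krasner_distr (krasnerP R) a i (padded (hzero R) [:: x; hopp R x]).
rewrite (map_padded _ (fun y => hmul R (replace a i y))) /=.
rewrite (krasner_absorb (krasnerP R)) => <-.
exists (hzero R); first exact: hadd_opp.
exact: krasner_absorb (krasnerP R) a i.
Qed.

Lemma hyperideal_zero R (I : set R) :
  2 <= n -> hyperideal I -> I (hzero R).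
Proof.
move=> hn hI; have [x Ix] := hyperideal_nonempty hI.
have n0 : 0 < n by exact: leq_trans hn.
(* Multiply x in slot 0 by a 0 in slot 1. *)
pose i := Ordinal n0; pose j := Ordinal hn.
have := hyperideal_mul hI (fun=> hzero R) i Ix.
rewrite -(replace_id (replace _ i x) j) replaceE /=.
by rewrite (krasner_absorb (krasnerP R)).
Qed.

Lemma hyperideal_one R (e : R) (I : set R) :
  2 <= n -> scalar_identity e -> hyperideal I -> I e -> I = setT.
Proof.
move=> hn ide hI Ie; apply/seteqP; split=> // x _.
rewrite -(ide x) -(replace_id (padded e [:: x]) (Ordinal hn)).
by apply: (hyperideal_mul hI); rewrite /padded.
Qed.

(** A factor may be exchanged between an inner and an outer product.  After
    moving the distinguished slots to the first place of [a] and to the last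
    place of [b], both sides are bracketings of the same word
    [b_0, ..., b_{n-2}, x, a_1, ..., a_{n-1}]. *)
Lemma hmul_swap R (comm : mul_commutative R) (a b : 'I_n -> R) i j (x : R) :
  hmul R (replace a i (hmul R (replace b j x))) =
  hmul R (replace b j (hmul R (replace a i x))).
Proof.
have slot (c : 'I_n -> R) k l y :
    hmul R (replace c k y) = hmul R (replace (fun p => c (tperm k l p)) l y).
  rewrite -(comm (tperm k l)); congr (hmul R _); apply/funext => p.
  by rewrite !replaceE -(inj_eq (@perm_inj _ (tperm k l)) p l) tpermR.
have n0 : 0 < n by exact: leq_ltn_trans (ltn_ord i).
have nn : n.-1 < n by rewrite prednK.
have le_last (l : 'I_n) : l <= n.-1 by rewrite -ltnS prednK.
pose i0 := Ordinal n0; pose jl := Ordinal nn.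
rewrite !(slot a i i0) !(slot b j jl).
set a' := (fun p => a _); set b' := (fun p => b _).
pose w l : R := if l < n.-1 then b' (insubd jl l) else
  if l == n.-1 then x else a' (insubd i0 (l - n.-1)).
have inner_b : block w i0 = replace b' jl x.
  apply/funext => l; rewrite /block /w replaceE -val_eqE /= add0n.
  case: (ltngtP l n.-1) => [ln|ln|_] //=; first by rewrite valKd.
  by have := le_last l; rewrite leqNgt ln.
have inner_a : block w jl = replace a' i0 x.
  apply/funext => l; rewrite /block /w replaceE -val_eqE /=.
  rewrite ltnNge leq_addr /= -{2}(addn0 n.-1) eqn_add2l addKn.
  by rewrite valKd.
have outer_a y : nested w i0 y = replace a' i0 y.
  apply/funext => l; rewrite /nested replaceE /= -val_eqE /=.
  case: eqP => // /eqP; rewrite -lt0n => l0.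
  have -> : (l + n).-1 = n.-1 + l by rewrite addnC -!subn1 addnBAC.
  by rewrite /w ltnNge leq_addr /= -{2}(addn0 n.-1) eqn_add2l addKn
    valKd (gtn_eqF l0).
have outer_b y : nested w jl y = replace b' jl y.
  apply/funext => l; rewrite /nested replaceE /= -val_eqE /=.
  case: (ltngtP l n.-1) => [ln|ln|] //.
    by rewrite /w ln valKd.
  by have := le_last l; rewrite leqNgt ln.
rewrite -inner_b -inner_a -outer_a -outer_b.
exact: krasner_assoc (krasnerP R) w i0 jl.
Qed.

(** The colon hyperideal of [I] by the product of the entries of [a] other
    than the one in slot [i]. *)
Definition colon R (I : set R) (a : 'I_n -> R) (i : 'I_n) : set R :=
  [set x | I (hmul R (replace a i x))].

Lemma sub_colon R (I : set R) a i : hyperideal I -> I `<=` colon I a i.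
Proof. by move=> hI x; exact: hyperideal_mul. Qed.

Lemma hyperideal_colon R (comm : mul_commutative R) (I : set R) a i :
  hyperideal I -> hyperideal (colon I a i).
Proof.
move=> hI; split.
- by have [x Ix] := hyperideal_nonempty hI; exists x; exact: sub_colon.
- move=> x Ix y xy; apply: (hyperideal_add hI) Ix _ _.
  rewrite -(krasner_distr (krasnerP R)).
  by exists y.
- by move=> x Ix; rewrite /colon /= hmul_opp; exact: hyperideal_opp.
- move=> b j x Ix; rewrite /colon /= hmul_swap //.
  exact: hyperideal_mul.
Qed.

Definition generated R (A : set R) : set R :=
  \bigcap_(J in [set J : set R | hyperideal J /\ A `<=` J]) J.

Lemma sub_generated R (A : set R) : A `<=` generated A.
Proof. by move=> x Ax J [_]; exact. Qed.

Lemma generated_sub R (A J : set R) :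
  hyperideal J -> A `<=` J -> generated A `<=` J.
Proof. by move=> hJ AJ x; apply. Qed.

Lemma hyperideal_generated R (A : set R) : A !=set0 -> hyperideal (generated A).
Proof.
move=> [x Ax]; split; first by exists x; exact: sub_generated.
- move=> a Aa y ay J JA; have [hJ _] := JA.
  by apply: (hyperideal_add hJ _ ay) => i; exact: Aa.
- move=> y Ay J JA; have [hJ _] := JA.
  by apply: hyperideal_opp => //; exact: Ay.
- move=> a i y Ay J JA; have [hJ _] := JA.
  by apply: hyperideal_mul => //; exact: Ay.
Qed.

(** If [g(a) \in I], then any product of elements of the hyperideals generated
    by [I] and the [a_i] lies in [I]: the factors are changed one at a time,
    each time because a colon hyperideal containing [I] and [a_i] contains all
    that they generate. *)
Lemma hmul_generated R (comm : mul_commutative R) (I : set R)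
    (a s : 'I_n -> R) :
  hyperideal I -> I (hmul R a) ->
  (forall i, generated (I `|` [set a i]) (s i)) -> I (hmul R s).
Proof.
move=> hI Ia sa.
suff step k : k <= n ->
    I (hmul R (fun i : 'I_n => if i < k then s i else a i)).
  have := step n (leqnn n); congr (I (hmul R _)).
  by apply/funext => i; rewrite ltn_ord.
elim: k => [|k IH] kn; first by [].
pose i := Ordinal kn; set t := fun _ => _.
have ti : t i = s i by rewrite /t /= ltnSn.
rewrite -(replace_id t i) ti.
suff : generated (I `|` [set a i]) `<=` colon I t i by apply; exact: sa.
apply: generated_sub; first exact: hyperideal_colon.
move=> x [Ix|->]; first exact: sub_colon.
have := IH (ltnW kn); congr (I (hmul R _)); apply/funext => j.
rewrite replaceE /t ltnS [j <= k]leq_eqVlt -val_eqE /=.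
by case: eqP => [/= jk|//]; rewrite jk ltnn; congr a; exact: val_inj.
Qed.

(** * Prime hyperideals avoiding a multiplicatively closed set *)

Lemma chain_upper_bound (T : Type) (F : set (set T)) (I : set T) (k : nat)
    (a : 'I_k -> T) :
  F !=set0 -> total_on F subset ->
  (forall i, (I `|` \bigcup_(X in F) X) (a i)) ->
  exists2 X, F X & forall i, (I `|` X) (a i).
Proof.
move=> [X0 FX0] tot aF.
suff [X FX Xa] : exists2 X, F X & forall i, i \in enum 'I_k -> (I `|` X) (a i).
  by exists X => // i; apply: Xa; rewrite mem_enum.
elim: (enum _) => [|i s [X FX Xs]]; first by exists X0.
case: (aF i) => [Ii|[Y FY Yi]].
  by exists X => // j; rewrite inE => /predU1P[->|/Xs//]; left.
case: (tot _ _ FX FY) => XY.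
- exists Y => // j; rewrite inE => /predU1P[->|/Xs]; first by right.
  by apply: setUS.
- exists X => // j; rewrite inE => /predU1P[->|/Xs//].
  by right; exact: XY.
Qed.

Lemma maximal_avoiding R (I S : set R) :
  hyperideal I -> I `&` S = set0 ->
  exists M : set R, [/\ hyperideal M, I `<=` M, M `&` S = set0 &
    forall J, hyperideal J -> M `<=` J -> J `&` S = set0 -> J `<=` M].
Proof.
move=> hI IS.
(* Sets are only required to work after adjoining I, so that the union of the
   empty chain qualifies. *)
have [F FP tot|A [[hA AS] maxA]] := @Zorn_bigcup R
    [set X | hyperideal (I `|` X) /\ (I `|` X) `&` S = set0].
  have [F0|/set0P F0] := eqVneq F set0.
    by rewrite F0 bigcup_set0 /= setU0.
  split; last first.
    rewrite -subset0 => x [[Ix|[X FX Xx]] Sx]; first by rewrite -IS.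
    by have [_ <-] := FP _ FX; split=> //; right.
  have sub X : F X -> I `|` X `<=` I `|` \bigcup_(X in F) X.
    by move=> FX; apply: setUS => x Xx; exists X.
  have one x : (I `|` \bigcup_(X in F) X) x -> exists2 X, F X & (I `|` X) x.
    case=> [Ix|[X FX Xx]]; last by exists X => //; right.
    by case: F0 => X FX; exists X => //; left.
  split.
  - by have [x Ix] := hyperideal_nonempty hI; exists x; left.
  - move=> a /(chain_upper_bound F0 tot)[X FX Xa]; have [hX _] := FP _ FX.
    by apply: subset_trans (sub _ FX); exact: hyperideal_add.
  - move=> x /one[X FX Xx]; have [hX _] := FP _ FX.
    by apply: (sub _ FX); exact: hyperideal_opp.
  - move=> a i x /one[X FX Xx]; have [hX _] := FP _ FX.
    by apply: (sub _ FX); exact: hyperideal_mul.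
exists (I `|` A); split=> // J hJ AJ JS.
have IJ : I `|` J = J by apply: setUidr => x Ix; apply: AJ; left.
apply: contrapT => nJ; apply: (maxA J); last by rewrite /= IJ.
split; first by move=> x Ax; apply: AJ; right.
by move=> JA; apply: nJ => x /JA; right.
Qed.

(** Krull's separation lemma.  A hyperideal [M] maximal among those avoiding [S]
    is prime: were no [a_i] in [M], each hyperideal generated by [M] and [a_i]
    would meet [S] in some [s_i], and [g(s)] would lie in both [S] and [M]. *)
Lemma prime_avoiding R (comm : mul_commutative R) (I S : set R) :
  hyperideal I -> S !=set0 -> I `&` S = set0 ->
  (forall s : 'I_n -> R, (forall i, S (s i)) -> S (hmul R s)) ->
  exists Q, [/\ prime_hyperideal Q, I `<=` Q & Q `&` S = set0].
Proof.
move=> hI [s0 Ss0] IS Smul.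
have [M [hM IM MS maxM]] := maximal_avoiding hI IS.
exists M; split=> //; split.
  by split=> // MT; rewrite -[False]/(set0 s0) -MS MT.
move=> a Ma; apply: contrapT => /forallNP nMa.
have /choice[s Ps] : forall i, exists s, generated (M `|` [set a i]) s /\ S s.
  move=> i; apply: contrapT => /forallNP nS; apply: (nMa i).
  apply: (maxM (generated (M `|` [set a i]))).
  - by apply: hyperideal_generated; exists (a i); right.
  - by apply: subset_trans (@sub_generated _ _); exact: subsetUl.
  - by rewrite -subset0 => x /nS.
  - by apply: sub_generated; right.
suff : (M `&` S) (hmul R s) by rewrite MS.
split.
  by apply: hmul_generated Ma _ => // i; case: (Ps i).
by apply: Smul => i; case: (Ps i).
Qed.

(** * Homomorphisms *)

Section Morphisms.
Context {R1 R2 : krasnerHyperring m n} {e1 : R1} {e2 : R2} {h : R1 -> R2}.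
Hypothesis hom : homomorphism e1 e2 h.

Lemma hom_mul_replace a i x :
  h (hmul R1 (replace a i x)) = hmul R2 (replace (fun j => h (a j)) i (h x)).
Proof. by rewrite (hom_mul hom) map_replace. Qed.

Lemma hom_mul_padded s :
  h (hmul R1 (padded e1 s)) = hmul R2 (padded e2 (map h s)).
Proof. by rewrite (hom_mul hom) map_padded (hom_one hom). Qed.

Lemma hom_add_padded (h0 : h (hzero R1) = hzero R2) s :
  h @` hadd R1 (padded (hzero R1) s) = hadd R2 (padded (hzero R2) (map h s)).
Proof. by rewrite (hom_add hom) map_padded h0. Qed.

Lemma hom_opp (h0 : h (hzero R1) = hzero R2) x :
  h (hopp R1 x) = hopp R2 (h x).
Proof.
apply: hopp_eq; rewrite -[[:: _; _]]/(map h [:: x; hopp R1 x]).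
rewrite -hom_add_padded // -h0.
by exists (hzero R1) => //; exact: hadd_opp.
Qed.

(** The image of [0] is neutral on the image of [h], which is everything, and
    the neutral element is unique. *)
Lemma surj_hom_zero : (forall y, exists x, h x = y) -> h (hzero R1) = hzero R2.
Proof.
move=> surj; apply: (hyp_zero_unique (krasner_hypergroup (krasnerP R2))) => y.
have [x <-] := surj y.
rewrite -[[:: h x]]/(map h [:: x]) -map_padded -(hom_add hom).
by rewrite (hyp_zero (krasner_hypergroup (krasnerP R1))) image_set1.
Qed.

Lemma hyperideal_preimage (J : set R2) :
  2 <= n -> h (hzero R1) = hzero R2 -> hyperideal J -> hyperideal (h @^-1` J).
Proof.
move=> hn h0 hJ; split.
- by exists (hzero R1); rewrite /= h0; exact: hyperideal_zero.
- move=> a Ja x ax; apply: (hyperideal_add hJ Ja).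
  by rewrite -(hom_add hom); exists x.
- by move=> x Jx; rewrite /= hom_opp //; exact: hyperideal_opp.
- by move=> a i x Jx; rewrite /= hom_mul_replace; exact: hyperideal_mul.
Qed.

Lemma proper_hyperideal_preimage (J : set R2) :
  2 <= n -> scalar_identity e2 -> h (hzero R1) = hzero R2 ->
  proper_hyperideal J -> proper_hyperideal (h @^-1` J).
Proof.
move=> hn id2 h0 [hJ JT]; split; first exact: hyperideal_preimage.
move=> pT; apply: JT; apply: (hyperideal_one hn id2) => //.
rewrite -(hom_one hom) -[J _]/((h @^-1` J) e1).
by rewrite pT.
Qed.

Lemma prime_hyperideal_preimage (Q : set R2) :
  2 <= n -> scalar_identity e2 -> h (hzero R1) = hzero R2 ->
  prime_hyperideal Q -> prime_hyperideal (h @^-1` Q).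
Proof.
move=> hn id2 h0 [pQ primeQ]; split; first exact: proper_hyperideal_preimage.
by move=> a; rewrite /= (hom_mul hom); exact: primeQ.
Qed.

(** A prime [Q] containing the preimage of [J] need not be a preimage itself.
    The image of the complement of [Q] is however multiplicatively closed and
    avoids [J], so some prime over [J] avoids it, whereas that prime contains
    [h y]. *)
Lemma preimage_radical (comm2 : mul_commutative R2) (J : set R2) :
  hyperideal J -> h @^-1` radical J `<=` radical (h @^-1` J).
Proof.
move=> hJ y rad_y Q [[_ primeQ] JQ]; apply: contrapT => nQy.
pose S := h @` ~` Q.
have Shy : S (h y) by exists y.
have JS : J `&` S = set0.
  rewrite -subset0 => z [Jz [x nQx hx]].
  by apply: nQx; apply: JQ; rewrite /= hx.
have Smul (s : 'I_n -> R2) : (forall i, S (s i)) -> S (hmul R2 s).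
  move=> Ss; have /choice[t Pt] : forall i, exists t, ~ Q t /\ h t = s i.
    by move=> i; have [t nQt ht] := Ss i; exists t.
  exists (hmul R1 t); first by move=> /primeQ[i]; case: (Pt i).
  by rewrite (hom_mul hom); congr (hmul R2 _); apply/funext => i; case: (Pt i).
have [Q2 [pQ2 JQ2 Q2S]] := prime_avoiding comm2 hJ (ex_intro _ _ Shy) JS Smul.
suff : (Q2 `&` S) (h y) by rewrite Q2S.
by split=> //; apply: rad_y.
Qed.

Lemma image_radical (I : set R1) :
  2 <= n -> scalar_identity e2 -> h (hzero R1) = hzero R2 ->
  h @` radical I `<=` radical (h @` I).
Proof.
move=> hn id2 h0 _ [y rad_y <-] Q [pQ IQ].
apply: (rad_y (h @^-1` Q)); split; first exact: prime_hyperideal_preimage.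
by move=> x Ix; apply: IQ; exists x.
Qed.

(** If [h x = h p] then the difference [x - p] contains an element [k] of the
    kernel, and reversibility recovers [x] in [k + p]. *)
Lemma hyperideal_saturated (I : set R1) :
  2 <= m -> 2 <= n -> h (hzero R1) = hzero R2 ->
  hyperideal I -> hom_kernel h `<=` I -> h @^-1` (h @` I) `<=` I.
Proof.
move=> hm hn h0 hI kerI x [p Ip hp].
have m0 : 0 < m by exact: leq_trans hm.
have [k xpk hk] :
    (h @` hadd R1 (padded (hzero R1) [:: x; hopp R1 p])) (hzero R2).
  by rewrite hom_add_padded //= hom_opp // -hp; exact: hadd_opp.
have := hyp_reversible (krasner_hypergroup (krasnerP R1)) xpk (Ordinal m0).
apply: (hyperideal_add hI) => -[[|j] jm]; first exact: kerI.
rewrite /padded /=; set s := filter _ _.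
have I0 := hyperideal_zero hn hI.
case: (ltnP j (size s)) => js; last by rewrite nth_default ?size_map.
rewrite (nth_map (Ordinal m0)) //; apply: (hyperideal_opp hI).
have := mem_nth (Ordinal m0) js; rewrite mem_filter => /andP[].
case: (nth _ _ _) => -[|[|l]] lm //= _ _; first exact: hyperideal_opp.
by rewrite nth_nil.
Qed.

Lemma hyperideal_image (I : set R1) :
  (forall y, exists x, h x = y) -> hyperideal I -> hyperideal (h @` I).
Proof.
move=> surj hI; have h0 := surj_hom_zero surj; split.
- by have [x Ix] := hyperideal_nonempty hI; exists (h x), x.
- move=> a Ia; have /choice[b Pb] : forall i, exists x, I x /\ h x = a i.
    by move=> i; have [x Ix hx] := Ia i; exists x.
  have <- : (fun i => h (b i)) = a by apply/funext => i; case: (Pb i).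
  rewrite -(hom_add hom); apply: image_subset.
  by apply: (hyperideal_add hI) => i; case: (Pb i).
- move=> _ [x Ix <-]; exists (hopp R1 x); first exact: hyperideal_opp.
  exact: hom_opp.
- move=> a i _ [x Ix <-]; have /choice[b hb] := fun j => surj (a j).
  exists (hmul R1 (replace b i x)); first exact: hyperideal_mul.
  by rewrite hom_mul_replace; congr (hmul R2 (replace _ _ _)); exact/funext.
Qed.

End Morphisms.
End Hyperideals.
End Hyperrings.

(* In the first part "h 0 = 0" is needed: with the sign hyperfield S and any R,
   x |-> (x, 1) is an injective homomorphism R -> R * S for which the preimage
   of the wsq-primary hyperideal {0} is empty.  For surjective h it is
   automatic. *)
Theorem theorem4p11 (m n : nat) (hm : 2 <= m) (hn : 2 <= n)
    (R1 R2 : krasnerHyperring m n) (e1 : R1) (e2 : R2)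
    (comm1 : mul_commutative R1) (comm2 : mul_commutative R2)
    (id1 : scalar_identity e1) (id2 : scalar_identity e2)
    (e1_neq0 : e1 <> hzero R1) (e2_neq0 : e2 <> hzero R2)
    (h : R1 -> R2) (hom : homomorphism e1 e2 h) :
  (monomorphism e1 e2 h -> h (hzero R1) = hzero R2 ->
    forall P2 : set R2, wsq_primary e2 P2 -> wsq_primary e1 (h @^-1` P2)) /\
  (epimorphism e1 e2 h ->
    forall P1 : set R1, wsq_primary e1 P1 -> hom_kernel h `<=` P1 ->
      wsq_primary e2 (h @` P1)).
Proof.
split.
- move=> [_ inj] h0 P2 [pP2 wsq].
  split; first exact: (proper_hyperideal_preimage hom hn id2 h0 pP2).
  move=> r r0 Pr; rewrite /= (hom_mul hom) in Pr.
  have hr0 : hmul R2 (fun i => h (r i)) <> hzero R2.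
    by rewrite -(hom_mul hom) -h0 => /inj.
  have [i [sq|rad]] := wsq _ hr0 Pr; exists i; [left|right].
  + by rewrite /= (hom_mul_padded hom).
  + apply: (preimage_radical hom comm2 (proj1 pP2)).
    by rewrite /= (hom_mul_replace hom) (hom_one hom).
- move=> [_ surj] P1 [[hP1 P1T] wsq] kerP1.
  have h0 := surj_hom_zero hom surj.
  have sat := hyperideal_saturated hom hm hn h0 hP1 kerP1.
  split.
    split; first exact: (hyperideal_image hom surj hP1).
    move=> hT; apply: P1T; apply/seteqP; split=> // x _; apply: sat.
    by rewrite /preimage /mkset hT.
  move=> r; have /choice[t ht] := fun i => surj (r i).
  have <- : (fun i => h (t i)) = r by exact/funext.
  rewrite -(hom_mul hom) => r0 /sat Pt.
  have t0 : hmul R1 t <> hzero R1 by move=> t0; rewrite t0 in r0.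
  have [i [sq|rad]] := wsq _ t0 Pt; exists i; [left|right].
  + rewrite -[[:: _; _]]/(map h [:: t i; t i]) -(hom_mul_padded hom).
    by exists (hmul R1 (padded e1 [:: t i; t i])).
  + rewrite -(hom_one hom) -(hom_mul_replace hom).
    by apply: (image_radical hom hn id2 h0); exists (hmul R1 (replace t i e1)).
Qed.
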